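(* Let $G$ be a Gaussian process on $[0,1]$, observed at $i/n$, $i=1,\dots,n$, such that $G-\mathbb{E}G$ is stationary with the Gaussian covariance function $$K(r)=\sigma^2\exp\left[-\frac12\left(\frac r\rho\right)^2\right],\qquad \sigma,\rho\in(0,\infty).$$ Let $\delta\in(0,1)$, and consider the GLRT $T_{GLRT}$ (known covariance, threshold $R_{n,\delta}$) for the shift-in-mean problem described in the context. There are $R_{n,\delta}>0$, $n_0=n_0(\rho)$, $C_0=C_0(\rho)>0$ and a universal constant $C>0$ such that if $n\ge n_0$ and $$|b|\ge C\sqrt{\exp\left[-n\log(C_0n)\right]\log\left(\frac{n(1-2\alpha)}{\delta}\right)},$$ then $\varphi_n(T_{GLRT})\le\delta$.
   Context: Observations: $\boldsymbol X=(X_1,\dots,X_n)^\top$ with $X_k=G(k/n)$, a Gaussian vector with known covariance matrix $\Sigma_n=[K((r-s)/n)]_{r,s=1}^n$. Testing problem: fix $\alpha\in(0,1/2)$ and let $\mathcal{C}_{n,\alpha}=\{t\in\{1,\dots,n\}: t\wedge(n-t)>\alpha n\}$. For $t\in\mathcal{C}_{n,\alpha}$ let $\zeta_t\in\mathbb{R}^n$ have $\zeta_t(k)=-1$ for $k\le t$ and $\zeta_t(k)=+1$ for $k>t$. The null hypothesis is $\mathbb{H}_0:\mathbb{E}\boldsymbol X=0$; the alternative with change point $t$ and jump $b\neq0$ is $\mathbb{H}_{1,t}:\mathbb{E}\boldsymbol X=\frac b2\zeta_t$ (same covariance). The GLRT with threshold $R_{n,\delta}$ is $$T_{GLRT}=\mathbb{1}\left(\max_{t\in\mathcal{C}_{n,\alpha}}\left|\frac{\zeta_t^\top\Sigma_n^{-1}\boldsymbol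 X}{\sqrt{\zeta_t^\top\Sigma_n^{-1}\zeta_t}}\right|^2\ge R_{n,\delta}\right).$$ For a test $T\in\{0,1\}$ (a function of $\boldsymbol X$), the conditional detection error probability is $\varphi_n(T)=\mathbb{P}(T=1\mid\mathbb{H}_0)+\max_{t\in\mathcal{C}_{n,\alpha}}\mathbb{P}(T=0\mid\mathbb{H}_{1,t})$, where under $\mathbb{H}_{1,t}$ the jump size is $b$.
   Formalization: The sample-size bound n_0 is allowed to depend on σ and α as well as ρ; with n_0 = n_0(ρ) alone the claim fails, since for fixed n and b letting σ → ∞ (or α → 1/2 with n(1−2α) = δ and b small) drives φ_n to 1. *)

(* Defs.v *)
From HB Require Import structures.
From mathcomp Require Export all_boot all_order all_algebra.
From mathcomp Require Export all_classical all_reals all_analysis.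
Export Order.TTheory GRing.Theory Num.Theory.
Export numFieldNormedType.Exports.

Set Implicit Arguments.
Unset Strict Implicit.
Unset Printing Implicit Defensive.

Local Open Scope classical_set_scope.
Local Open Scope ring_scope.

(* [normal_prob m 0] is not the point mass at [m], so zero variance is treated
   separately. *)
Definition gaussian_law (R : realType) (m s : R) : set R -> \bar R :=
  if s == 0 then \d_m else normal_prob m s.

Section process.
Context (R : realType) (d : measure_display) (Omega : measurableType d).

(* A process on [0, 1] is a family [G : R -> {mfun Omega >-> R}] of which only
   the members indexed by [0, 1] are constrained or used. It is Gaussian when
   every finite linear combination of its values has a (possibly degenerate)
   normal law. *)
Definition gaussian_process (P : probability Omega R)
    (G : R -> {mfun Omega >-> R}) : Prop :=
  forall (m : nat) (c u : 'I_m -> R), (forall i, 0 <= u i <= 1) ->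
  exists mu s : R, 0 <= s /\
    forall A : set R, measurable A ->
      pushforward P (fun w => \sum_(i < m) c i * G (u i) w) A =
      gaussian_law mu s A.

(* G - E G has covariance function (s, t) |-> K (s - t) on [0, 1]; for a
   Gaussian process this is stationarity of G - E G with covariance K. *)
Definition stationary_covariance (P : probability Omega R)
    (G : R -> {mfun Omega >-> R}) (K : R -> R) : Prop :=
  forall s t : R, 0 <= s <= 1 -> 0 <= t <= 1 ->
    covariance P (G s) (G t) = (K (s - t))%:E.

(* Index [k : 'I_n] stands for the observation number k + 1. *)
Definition observation (G : R -> {mfun Omega >-> R}) (n : nat) (w : Omega) :
    'cV[R]_n :=
  \col_(k < n) G (k.+1%:R / n%:R) w.

Definition has_mean (P : probability Omega R) (G : R -> {mfun Omega >-> R})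
    (n : nat) (m : 'cV[R]_n) : Prop :=
  forall k : 'I_n, ('E_P[fun w => (observation G n w k 0)%R] = (m k 0)%R%:E)%E.

Definition observation_model (P : probability Omega R)
    (G : R -> {mfun Omega >-> R}) (K : R -> R) (n : nat) (m : 'cV[R]_n) :
    Prop :=
  [/\ gaussian_process P G, stationary_covariance P G K & has_mean P G m].

End process.

Section testing.
Context (R : realType).

Definition gaussian_kernel (sigma rho r : R) : R :=
  sigma ^+ 2 * expR (- (2^-1 * (r / rho) ^+ 2)).

(* The entry K ((r - s) / n) does not depend on indices starting at 0 or 1. *)
Definition cov_matrix (K : R -> R) (n : nat) : 'M[R]_n :=
  \matrix_(r < n, s < n) K ((r%:R - s%:R) / n%:R).

Definition change_points (n : nat) (alpha : R) : {set 'I_n.+1} :=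
  [set t : 'I_n.+1 | (0 < t)%N && (alpha * n%:R < (minn t (n - t))%:R)].

(* The condition k <= t on observation numbers reads k.+1 <= t here, since
   [k : 'I_n] starts at 0. *)
Definition zeta (n : nat) (t : 'I_n.+1) : 'cV[R]_n :=
  \col_(k < n) (if (k.+1 <= t)%N then -1 else 1).

Definition glrt_statistic (n : nat) (Sigma : 'M[R]_n) (t : 'I_n.+1)
    (x : 'cV[R]_n) : R :=
  `| ((zeta t)^T *m invmx Sigma *m x) 0 0 /
     Num.sqrt (((zeta t)^T *m invmx Sigma *m zeta t) 0 0) | ^+ 2.

Definition glrt (n : nat) (Sigma : 'M[R]_n) (alpha thr : R) (x : 'cV[R]_n) :
    bool :=
  thr <= \big[Num.max/0]_(t in change_points n alpha) glrt_statistic Sigma t x.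

(* [P0] is the probability under the null and [P1 t] the one under the
   alternative with change point t. *)
Definition detection_error (d : measure_display) (Omega : measurableType d)
    (n : nat) (alpha : R) (P0 : probability Omega R)
    (P1 : 'I_n.+1 -> probability Omega R)
    (X : Omega -> 'cV[R]_n) (T : 'cV[R]_n -> bool) : \bar R :=
  (P0 [set w | T (X w)] +
   \big[maxe/0]_(t in change_points n alpha) P1 t [set w | ~~ T (X w)])%E.

End testing.

(* Main.v *)
From HB Require Import structures.
Require Import Defs.
From mathcomp Require Import measurable_realfun ring lra zify.

(** Why the theorem holds.  The statistic of the change point [t] is the square
    of a normalized linear statistic [Y_t] of the Gaussian vector [X]: it has
    variance 1, mean 0 under the null hypothesis and mean [(b / 2) sqrt q_t]
    under the alternative, where [q_t = zeta_t^T Sigma^-1 zeta_t].  A union bound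
    over at most [n + 1] change points and the Gaussian tail bound
    [P (|N| >= x) <= 2 exp (- x^2 / 2)] show that a threshold of order
    [log (n / delta)] controls both kinds of error as soon as [b^2 q_t] is a large
    multiple of that threshold.  The theorem thus reduces to the estimate
    [q_t >= (C0 n)^n] ([signal_strength_lb]): the samples of so smooth a process
    are so strongly dependent that the signal-to-noise ratio is superexponential.

    Lower bound on [q_t].  By the Cauchy-Schwarz inequality for the bilinear form
    of [Sigma], [q_t >= (v^T zeta_t)^2 / (v^T Sigma v)] for every vector [v]
    ([quad_invmx_ge]).  Take for [v] the finite difference of order [m = n - 1],
    [v_k = (-1)^k C(m, k)].  On the one hand a partial alternating sum of
    binomial coefficients is again a signed binomial coefficient, so that
    [|v^T zeta_t| >= 2] ([alt_vec_dot_zeta]).  On the other hand [v] annihilates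
    polynomials of degree less than [m], hence the bilinear expression
    [v^T Sigma v] does not see the Taylor polynomial of degree less than [m] of
    [exp] in the exponent [- ((r - s) / (n rho))^2 / 2], and only the remainder, of
    order [(2 rho^2)^-m / m!], is left ([quad_cov_alt_vec]).  The factor [1 / m!]
    is the source of the rate [exp (- n log (C0 n))].

    Invertibility of [Sigma] is needed to speak of [q_t].  The factorization
    [exp (- (x - y)^2 / 2) = exp (- x^2 / 2) exp (- y^2 / 2) sum_k (x y)^k / k!]
    writes [w^T Sigma w] as a sum of squares of moments of a reweighting of [w];
    if all of them vanish then so does [w], the sampling points being distinct
    ([quad_cov_eq0]).

    Gaussian part.  Everything about a normal variable is read off its moment
    generating function [t |-> exp (t^2 v / 2)] (after centering), which is
    obtained by completing the square in the density: integrability, the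
    mean, a bound on the parameter [v] by the variance, and the Chernoff bound.
    This identifies the law of [Y_t], about which the hypotheses say only that
    it is normal with some parameters. *)

Set Implicit Arguments.
Unset Strict Implicit.
Unset Printing Implicit Defensive.
Local Open Scope ring_scope.
Local Open Scope classical_set_scope.

(** * Taylor remainder of the exponential *)

Section exp_taylor.
Context {R : realType}.
Implicit Types x : R.

Lemma exp_partial_sum_le x n : 0 <= x -> \sum_(j < n) x ^+ j / j`!%:R <= expR x.
Proof.
move=> x0; rewrite -(big_mkord xpredT (fun j => x ^+ j / j`!%:R)).
apply: (@nondecreasing_cvgn_le _ (series (exp_coeff x))).
  apply/nondecreasing_seqP => k; rewrite /series/= big_nat_recr//= lerDl.
  by rewrite /exp_coeff/= divr_ge0// exprn_ge0.
exact: is_cvg_series_exp_coeff.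
Qed.

(** Since [(m + i)! >= m! i!], the tail of the exponential series from index [m]
    on is at most [|x|^m / m!] times the exponential series at [|x|]. *)
Lemma exp_taylor_remainder x m :
  `|expR x - \sum_(j < m) x ^+ j / j`!%:R| <= `|x| ^+ m / m`!%:R * expR `|x|.
Proof.
have cvx : (fun N => `|series (exp_coeff x) N - \sum_(j < m) x ^+ j / j`!%:R|)
    @ \oo --> `|expR x - \sum_(j < m) x ^+ j / j`!%:R|.
  apply: cvg_norm; apply: cvgB; last exact: cvg_cst.
  exact: is_cvg_series_exp_coeff.
rewrite -(cvg_lim (@Rhausdorff R) cvx); apply: limr_le; first exact: cvgP cvx.
exists m => // N /= mN.
rewrite -(big_mkord xpredT (fun j => x ^+ j / j`!%:R)) /series/=.
rewrite (big_cat_nat (leq0n m) mN)/= addrAC subrr add0r.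
apply: (le_trans (ler_norm_sum _ _ _)).
rewrite -{1}(add0n m) big_addn big_mkord.
apply: (@le_trans _ _ (\sum_(i < N - m)
    `|x| ^+ m / m`!%:R * (`|x| ^+ i / i`!%:R))).
  apply: ler_sum => i _; rewrite /exp_coeff/= normrM normrX normfV normr_nat.
  rewrite addnC exprD mulf_div -natrM ler_wpM2l ?mulr_ge0 ?exprn_ge0//.
  rewrite lef_pV2 ?posrE ?ltr0n ?muln_gt0 ?fact_gt0// ler_nat.
  have := bin_fact (leq_addr i m); rewrite addKn => <-.
  by rewrite leq_pmull// bin_gt0 leq_addr.
by rewrite -mulr_sumr ler_wpM2l ?exp_partial_sum_le.
Qed.

End exp_taylor.

(** * Finite differences *)

Section alternating_binomial.
Context {R : numFieldType}.

Definition alt_binom m k : R := (-1) ^+ k * 'C(m, k)%:R.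

(** Pascal's rule: a difference of order [m + 1] is a difference of order [m] of
    a first difference. *)
Lemma sum_alt_binomS m (f : nat -> R) :
  \sum_(k < m.+2) alt_binom m.+1 k * f k =
  \sum_(k < m.+1) alt_binom m k * (f k - f k.+1).
Proof.
rewrite big_ord_recl.
under eq_bigr do rewrite /alt_binom lift0 binS natrD mulrDr mulrDl.
rewrite big_split/= big_ord_recr/= bin_small// mulr0 mul0r addr0.
under [RHS]eq_bigr do rewrite mulrBr.
rewrite big_split/= [in RHS]big_ord_recl /= addrA; congr (_ + _ + _).
- by rewrite /alt_binom !bin0.
- by apply: eq_bigr => i _; rewrite /alt_binom exprS !mulNr mul1r.
Qed.

(** A first difference lowers the degree of a polynomial by one, so a difference
    of order [m] kills the monomials of degree less than [m]. *)
Lemma alt_binom_moment m a : (a < m)%N ->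
  \sum_(k < m.+1) alt_binom m k * k%:R ^+ a = 0.
Proof.
elim: m a => // m IH a am.
rewrite (sum_alt_binomS m (fun k => k%:R ^+ a)).
under eq_bigr => k _.
  rewrite -natr1 exprD1n big_ord_recr/= binn mulr1n opprD addrCA subrr addr0.
  rewrite -sumrN mulr_sumr.
  over.
rewrite exchange_big big1// => i _.
under eq_bigr do rewrite mulrN mulrnAr.
rewrite sumrN.
by rewrite sumrMnl (IH i) ?mul0rn ?oppr0// (leq_trans (ltn_ord i)).
Qed.

(** Telescoping of Pascal's rule.  It evaluates the finite difference vector
    against a step function. *)
Lemma sum_alt_binom_partial m t :
  \sum_(k < t.+1) alt_binom m.+1 k = alt_binom m t.
Proof.
elim: t => [|t IH]; first by rewrite big_ord1 /alt_binom !bin0.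
rewrite big_ord_recr/= IH /alt_binom binS natrD exprS.
ring.
Qed.

Lemma sum_norm_alt_binom m : \sum_(k < m.+1) `|alt_binom m k| = 2 ^+ m.
Proof.
rewrite -[2]/(1 + 1) exprD1n; apply: eq_bigr => i _.
by rewrite /alt_binom normrM normrX normrN1 expr1n mul1r normr_nat.
Qed.

(** Every monomial [r^p s^q] in the expansion of [(r - s)^(2 j)] has [p < m] or
    [q < m], and is then killed by the sum over [r] or over [s]. *)
Lemma alt_binom_diff_moment m j : (j < m)%N ->
  \sum_(r < m.+1) \sum_(s < m.+1)
    alt_binom m r * alt_binom m s * (r%:R - s%:R) ^+ j.*2 = 0.
Proof.
move=> jm.
under eq_bigr => r _.
  under eq_bigr => s _.
    rewrite exprBn mulr_sumr.
    over.
  rewrite exchange_big.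
  over.
rewrite exchange_big big1//= => i _.
transitivity ((-1) ^+ i * 'C(j.*2, i)%:R *
  (\sum_(r < m.+1) alt_binom m r * r%:R ^+ (j.*2 - i)) *
  (\sum_(s < m.+1) alt_binom m s * s%:R ^+ i) : R).
  rewrite -mulrA mulr_suml mulr_sumr; apply: eq_bigr => r _.
  rewrite !mulr_sumr; apply: eq_bigr => s _.
  by rewrite -mulr_natr; ring.
have [im|mi] := ltnP i m.
  by rewrite (alt_binom_moment im) mulr0.
rewrite (@alt_binom_moment _ (j.*2 - i)%N) ?mulr0 ?mul0r//.
by have := ltn_ord i; lia.
Qed.

End alternating_binomial.

(** * Quadratic forms of positive definite matrices *)

Section quadratic_form.
Context {R : realType}.

Definition quad n (A : 'M[R]_n) (u v : 'cV[R]_n) : R := (u^T *m A *m v) 0 0.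

Lemma quadE n (A : 'M[R]_n) u v :
  quad A u v = \sum_(r < n) \sum_(s < n) u r 0 * v s 0 * A r s.
Proof.
rewrite /quad -mulmxA mxE; apply: eq_bigr => r _.
rewrite !mxE mulr_sumr; apply: eq_bigr => s _.
by rewrite [A r s * _]mulrC mulrA.
Qed.

Lemma quad_sym n (A : 'M[R]_n) u v : A^T = A -> quad A u v = quad A v u.
Proof.
move=> As; rewrite /quad -[in LHS]As.
have -> : u^T *m A^T *m v = (v^T *m A *m u)^T.
  by rewrite !trmx_mul trmxK mulmxA.
by rewrite mxE.
Qed.

Lemma quadDl n (A : 'M[R]_n) u v w : quad A (u + v) w = quad A u w + quad A v w.
Proof. by rewrite /quad linearD/= !mulmxDl mxE. Qed.

Lemma quadZl n (A : 'M[R]_n) a u v : quad A (a *: u) v = a * quad A u v.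
Proof. by rewrite /quad linearZ/= -!scalemxAl mxE. Qed.

(** The form is only assumed nonnegative: when [v] is isotropic, [u + lambda v]
    with [lambda] large of the right sign forces the mixed term to vanish. *)
Lemma quad_Cauchy_Schwarz n (A : 'M[R]_n) u v : A^T = A ->
  (forall w, 0 <= quad A w w) -> quad A u v ^+ 2 <= quad A u u * quad A v v.
Proof.
move=> As A0.
have key a b : 0 <= a ^+ 2 * quad A u u + 2 * a * b * quad A u v
                    + b ^+ 2 * quad A v v.
  have := A0 (a *: u + b *: v).
  rewrite quadDl !quadZl 2!(quad_sym _ (_ + _) As) !quadDl !quadZl.
  rewrite (quad_sym v u As); set x := quad A u v.
  suff -> : forall p q : R, a * (a * p + b * x) + b * (a * x + b * q) =
     a ^+ 2 * p + 2 * a * b * x + b ^+ 2 * q by [].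
  by move=> p q; ring.
have u0 := A0 u; have v0 := A0 v.
have [v1|v1] := eqVneq (quad A v v) 0; last first.
  have v_gt0 : 0 < quad A v v by rewrite lt_def v1.
  have := key (quad A v v) (- quad A u v).
  set p := quad A u u; set q := quad A v v; set x := quad A u v => h.
  have : 0 <= q * (p * q - x ^+ 2) by move: h; nra.
  by rewrite pmulr_rge0// subr_ge0.
rewrite v1 mulr0; have [->|x0] := eqVneq (quad A u v) 0; first by rewrite expr0n.
have := key 1 (- (quad A u u + 1) / (2 * quad A u v)).
rewrite v1 mulr0 addr0 expr1n mul1r mulr1 -mulrA.
suff -> : forall p x : R, x != 0 -> p + 2 * (- (p + 1) / (2 * x) * x) = -1.
  by rewrite lerNr oppr0 ler10.
  by [].
by move=> p x xn0; field.
Qed.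

Section positive_definite.
Variables (n : nat) (A : 'M[R]_n).
Hypothesis As : A^T = A.
Hypothesis A_ge0 : forall v, 0 <= quad A v v.
Hypothesis A_pd : forall v, quad A v v = 0 -> v = 0.

Lemma posdef_unitmx : A \in unitmx.
Proof.
rewrite -row_free_unit -kermx_eq0; apply/eqP/row_matrixP => i.
rewrite row0; apply: trmx_inj; rewrite trmx0; apply: A_pd.
by rewrite /quad trmxK -row_mul mulmx_ker row0 mul0mx mxE.
Qed.

Let uA := posdef_unitmx.

Lemma invmx_sym : (invmx A)^T = invmx A.
Proof. by rewrite trmx_inv As. Qed.

Lemma quad_invmx z : quad (invmx A) z z = quad A (invmx A *m z) (invmx A *m z).
Proof.
by rewrite /quad trmx_mul invmx_sym -(mulmxA _ (invmx A) A) mulVmx// mulmx1 mulmxA.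
Qed.

(** Cauchy-Schwarz for [v] and [A^-1 z].  It bounds the quadratic form of an
    inverse from below without computing the inverse: any single test vector
    [v] gives a bound. *)
Lemma quad_invmx_ge z v :
  (v^T *m z) 0 0 ^+ 2 <= quad A v v * quad (invmx A) z z.
Proof.
rewrite quad_invmx.
have -> : (v^T *m z) 0 0 = quad A v (invmx A *m z).
  by rewrite /quad -mulmxA mulKVmx.
exact: quad_Cauchy_Schwarz.
Qed.

Lemma quad_invmx_gt0 z : z != 0 -> 0 < quad (invmx A) z z.
Proof.
move=> z0; rewrite quad_invmx lt_def A_ge0 andbT; apply: contra z0 => /eqP.
move=> /A_pd h; by rewrite -(mulKVmx uA z) h mulmx0.
Qed.

End positive_definite.
End quadratic_form.

(** * The Gaussian covariance matrix *)

Section gaussian_kernel_matrix.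
Context {R : realType}.
Variables (sigma rho : R).
Hypotheses (sigma0 : 0 < sigma) (rho0 : 0 < rho).

Local Notation S n := (cov_matrix (gaussian_kernel sigma rho) n).

Lemma cov_matrix_sym n : (S n)^T = S n.
Proof.
apply/matrixP => i j; rewrite !mxE /gaussian_kernel.
by congr (_ * expR (- (_ * _))); rewrite -[in LHS]opprB !mulNr sqrrN.
Qed.

(** The exponential kernel is the sum over [k] of the nonnegative forms
    [(sum_r w_r x_r^k)^2 / k!], so it dominates each of them. *)
Lemma exp_kernel_term_le n (x w : 'I_n -> R) k :
  (\sum_(r < n) w r * x r ^+ k) ^+ 2 / k`!%:R <=
  \sum_(r < n) \sum_(s < n) w r * w s * expR (x r * x s).
Proof.
have cv : (fun N => \sum_(r < n) \sum_(s < n)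
     w r * w s * series (exp_coeff (x r * x s)) N) @ \oo -->
   \sum_(r < n) \sum_(s < n) w r * w s * expR (x r * x s).
  apply: cvg_big => [|r _]; first exact: add_continuous.
  apply: cvg_big => [|s _]; first exact: add_continuous.
  apply: cvgM; first exact: cvg_cst.
  exact: is_cvg_series_exp_coeff.
rewrite -(cvg_lim (@Rhausdorff R) cv); apply: limr_ge; first exact: cvgP cv.
exists k.+1 => // N /= kN.
have -> : \sum_(r < n) \sum_(s < n)
     w r * w s * series (exp_coeff (x r * x s)) N =
   \sum_(0 <= j < N) (\sum_(r < n) w r * x r ^+ j) ^+ 2 / j`!%:R.
  under eq_bigr => r _.
    under eq_bigr => s _.
      rewrite /series/= mulr_sumr.
      over.
    rewrite exchange_big.
    over.
  rewrite exchange_big; apply: eq_bigr => j _.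
  rewrite expr2 !mulr_suml; apply: eq_bigr => r _.
  rewrite mulr_sumr mulr_suml; apply: eq_bigr => s _.
  by rewrite /exp_coeff/= exprMn; ring.
rewrite big_mkord (bigD1 (Ordinal kN))//= lerDl sumr_ge0// => i _.
by rewrite divr_ge0// sqr_ge0.
Qed.

(** Vanishing moments make the weights orthogonal to all polynomials, among them
    those that vanish at all nodes but one. *)
Lemma moments_eq0 n (x w : 'I_n -> R) : injective x ->
  (forall k, \sum_(r < n) w r * x r ^+ k = 0) -> forall r, w r = 0.
Proof.
move=> xI mom0 r.
have wp (p : {poly R}) : \sum_(s < n) w s * p.[x s] = 0.
  under eq_bigr do rewrite horner_coef mulr_sumr.
  rewrite exchange_big big1// => i _.
  under eq_bigr do rewrite mulrCA.
  by rewrite -mulr_sumr mom0 mulr0.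
have /eqP := wp (\prod_(s < n | s != r) ('X - (x s)%:P)).
rewrite (bigD1 r)//= [X in _ + X]big1 ?addr0; last first.
  move=> s sr; rewrite horner_prod (bigD1 s)//= hornerXsubC subrr mul0r mulr0//.
rewrite mulf_eq0 horner_prod prodf_seq_eq0 => /orP[/eqP//|/hasP[s _ /andP[sr]]].
by rewrite hornerXsubC subr_eq0 => /eqP /xI rs; rewrite rs eqxx in sr.
Qed.

(* The sampling points in units of the correlation length. *)
Let loc n (r : 'I_n) : R := r%:R / (n%:R * rho).

(** Polarization, [- (x - y)^2 / 2 = - x^2 / 2 - y^2 / 2 + x y], turns the Gaussian
    kernel into the exponential kernel with reweighted coefficients. *)
Lemma quad_cov_exp n (v : 'cV[R]_n) :
  quad (S n) v v = sigma ^+ 2 * \sum_(r < n) \sum_(s < n)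
   (v r 0 * expR (- (loc r ^+ 2 / 2))) * (v s 0 * expR (- (loc s ^+ 2 / 2))) *
     expR (loc r * loc s).
Proof.
rewrite quadE mulr_sumr; apply: eq_bigr => r _.
rewrite mulr_sumr; apply: eq_bigr => s _; rewrite mxE /gaussian_kernel.
have -> : (r%:R - s%:R) / n%:R / rho = loc r - loc s.
  by rewrite /loc invfM -mulrA mulrBl.
have -> : - (2^-1 * (loc r - loc s) ^+ 2) =
  (- (loc r ^+ 2 / 2)) + (- (loc s ^+ 2 / 2)) + loc r * loc s by field.
by rewrite !expRD; ring.
Qed.

Lemma loc_inj n : injective (@loc n).
Proof.
move=> r s; rewrite /loc => h; apply/val_inj/eqP; rewrite -(eqr_nat R).
apply/eqP/(mulIf _ h); rewrite invr_eq0 mulf_neq0 ?gt_eqF// ltr0n.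
by case: n r s h => // -[].
Qed.

Lemma quad_cov_ge0 n (v : 'cV[R]_n) : 0 <= quad (S n) v v.
Proof.
rewrite quad_cov_exp mulr_ge0 ?sqr_ge0//.
by apply: le_trans (exp_kernel_term_le _ _ 0); rewrite divr_ge0 ?sqr_ge0.
Qed.

Lemma quad_cov_eq0 n (v : 'cV[R]_n) : quad (S n) v v = 0 -> v = 0.
Proof.
rewrite quad_cov_exp => /eqP; rewrite mulf_eq0 sqrf_eq0 (gt_eqF sigma0)/= => /eqP h.
apply/matrixP => r j; rewrite ord1 mxE.
pose w r := v r 0 * expR (- (loc r ^+ 2 / 2)).
have : w r = 0.
  apply: (moments_eq0 (@loc_inj n)) => k.
  have := exp_kernel_term_le (@loc n) w k; rewrite h.
  rewrite pmulr_lle0 ?invr_gt0 ?ltr0n ?fact_gt0// => h0.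
  by apply/eqP; rewrite -sqrf_eq0 eq_le h0 sqr_ge0.
by move/eqP; rewrite mulf_eq0 expR_eq0 orbF => /eqP.
Qed.

(** The test vector of the Cauchy-Schwarz bound: the finite difference of maximal
    order supported on the sample. *)
Definition alt_vec m : 'cV[R]_m.+1 := \col_k alt_binom m k.

(** The variance of the finite difference of the observations.  The Taylor
    polynomial of degree less than [m] of the exponential contributes nothing,
    and the remainder is uniformly small because the exponents stay below
    [1 / (2 rho^2)]; summing the absolute values of the weights costs [4^m]. *)
Lemma quad_cov_alt_vec m :
  quad (S m.+1) (alt_vec m) (alt_vec m) <=
  sigma ^+ 2 * (expR (2 * rho ^+ 2)^-1 * ((2 / rho ^+ 2) ^+ m / m`!%:R)).
Proof.
rewrite quadE.
pose y (r s : 'I_m.+1) : R := 2^-1 * ((r%:R - s%:R) / m.+1%:R / rho) ^+ 2.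
pose T (z : R) := \sum_(j < m) z ^+ j / j`!%:R.
have TE : \sum_(r < m.+1) \sum_(s < m.+1)
    alt_binom m r * alt_binom m s * T (- y r s) = 0.
  under eq_bigr => r _.
    under eq_bigr => s _.
      rewrite mulr_sumr.
      over.
    rewrite exchange_big.
    over.
  rewrite exchange_big big1//= => j _.
  transitivity ((- (2^-1 * ((m.+1%:R * rho) ^+ 2)^-1)) ^+ j / j`!%:R *
    (\sum_(r < m.+1) \sum_(s < m.+1)
      alt_binom m r * alt_binom m s * (r%:R - s%:R) ^+ j.*2) : R); last first.
    by rewrite alt_binom_diff_moment ?mulr0.
  rewrite mulr_sumr; apply: eq_bigr => r _.
  rewrite mulr_sumr; apply: eq_bigr => s _.
  have -> : (- y r s) ^+ j = (- (2^-1 * ((m.+1%:R * rho) ^+ 2)^-1)) ^+ j *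
      (r%:R - s%:R) ^+ j.*2.
    rewrite -mul2n exprM -exprMn; congr (_ ^+ _).
    by rewrite /y !exprMn invfM !exprVn; ring.
  move: (alt_binom m r) (alt_binom m s) (j`!%:R^-1 : R) => a b e.
  move: (_ ^+ j) => c; move: (_ ^+ _) => f; ring.
have y0 r s : 0 <= y r s by rewrite mulr_ge0 ?sqr_ge0.
have yle r s : y r s <= (2 * rho ^+ 2)^-1.
  rewrite /y exprMn exprVn (invfM 2) ler_wpM2l// ler_piMl ?invr_ge0 ?sqr_ge0//.
  rewrite -real_normK ?num_real// exprn_ile1// normrM normfV normr_nat.
  rewrite ler_pdivrMr ?ltr0n// mul1r ler_norml.
  have rm : r%:R <= m.+1%:R :> R by rewrite ler_nat ltnW.
  have sm : s%:R <= m.+1%:R :> R by rewrite ler_nat ltnW.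
  have r0 : 0 <= r%:R :> R by [].
  have s0 : 0 <= s%:R :> R by [].
  by apply/andP; split; lra.
pose B := (2 * rho ^+ 2)^-1 ^+ m / m`!%:R * expR (2 * rho ^+ 2)^-1.
have rem r s : `|expR (- y r s) - T (- y r s)| <= B.
  apply: le_trans (exp_taylor_remainder _ _) _; rewrite normrN ger0_norm//.
  by rewrite ler_pM ?mulr_ge0 ?exprn_ge0 ?expR_ge0 ?ler_expR// ler_wpM2r// lerXn2r
     ?nnegrE// (le_trans (y0 r s)).
apply: (@le_trans _ _ (sigma ^+ 2 * \sum_(r < m.+1) \sum_(s < m.+1)
    alt_binom m r * alt_binom m s * (expR (- y r s) - T (- y r s)))).
  rewrite le_eqVlt; apply/orP; left; apply/eqP.
  under [in RHS]eq_bigr do (under eq_bigr do rewrite mulrBr; rewrite sumrB).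
  rewrite sumrB TE subr0 mulr_sumr; apply: eq_bigr => r _.
  rewrite mulr_sumr; apply: eq_bigr => s _.
  by rewrite !mxE /gaussian_kernel mulrCA.
rewrite ler_wpM2l ?sqr_ge0//.
apply: (@le_trans _ _ (\sum_(r < m.+1) \sum_(s < m.+1)
    `|alt_binom m r| * `|alt_binom m s| * B)).
  apply: ler_sum => r _; apply: ler_sum => s _.
  apply: le_trans (ler_norm _) _; rewrite !normrM.
  by rewrite ler_wpM2l ?mulr_ge0.
rewrite le_eqVlt; apply/orP; left; apply/eqP.
transitivity ((2 ^+ m) ^+ 2 * B).
  rewrite -(sum_norm_alt_binom m) expr2 !mulr_suml; apply: eq_bigr => r _.
  by rewrite mulr_sumr mulr_suml.
rewrite /B mulrA mulrC; congr (_ * _).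
rewrite mulrA; congr (_ / _).
rewrite expr2 -!exprMn; congr (_ ^+ _).
by field; rewrite gt_eqF.
Qed.
End gaussian_kernel_matrix.

(** * Superexponential lower bound on the signal strength *)

Section signal_strength.
Context {R : realType}.

(** The weights sum to zero, so the scalar product is minus twice the partial
    sum up to [t], that is twice a binomial coefficient up to sign. *)
Lemma alt_vec_dot_zeta m (t : 'I_m.+2) : (0 < t <= m)%N ->
  4 <= ((alt_vec m)^T *m zeta R t) 0 0 ^+ 2.
Proof.
case: t => -[//|t] tm /= t_le_m; case: m tm t_le_m => // m tm t_le_m.
set v := (_ *m _) 0 0.
have -> : v = - 2 * alt_binom m t.
  have all0 : \sum_(k < m.+2) alt_binom m.+1 k = 0 :> R.
    rewrite -[RHS](@alt_binom_moment R m.+1 0)//.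
    by apply: eq_bigr => k _; rewrite expr0 mulr1.
  rewrite -sum_alt_binom_partial -[LHS]subr0 -[X in _ - X]all0 /v mxE -sumrB.
  rewrite (big_ord_widen m.+2 (fun k => alt_binom m.+1 k : R)) ?ltnS 1?ltnW//.
  rewrite mulr_sumr [RHS]big_mkcond/=; apply: eq_bigr => k _.
  by rewrite !mxE /=; case: ifP => _; ring.
rewrite exprMn sqrrN /alt_binom exprMn sqrr_sign mul1r.
have : 1 <= 'C(m, t)%:R :> R by rewrite ler1n bin_gt0.
set x := 'C(_, _)%:R; nra.
Qed.

(** The term of index [n] of the series of [exp n] is at most its sum: a weak
    form of Stirling's formula. *)
Lemma natXn_le_fact_exp n : n%:R ^+ n <= n`!%:R * expR 1 ^+ n :> R.
Proof.
rewrite -expRM_natl mulr1 mulrC -ler_pdivrMr ?ltr0n ?fact_gt0//.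
have := @exp_partial_sum_le R n%:R n.+1 (ler0n _ n).
apply: le_trans; by rewrite big_ord_recr/= lerDr sumr_ge0.
Qed.

Lemma sqr_le_exp4 n : (n ^ 2 <= 4 ^ n)%N.
Proof. by rewrite -[4%N]/(2 ^ 2)%N -expnM mulnC expnM leq_exp2r// ltnW// ltn_expl. Qed.

Variables (sigma rho : R).
Hypotheses (sigma0 : 0 < sigma) (rho0 : 0 < rho).
Local Notation S n := (cov_matrix (gaussian_kernel sigma rho) n).

(** The Cauchy-Schwarz bound with the finite difference vector gives a bound of
    order [m! (rho^2 / 2)^m] with [m = n - 1].  Up to a factor linear in [n] and
    constants depending on [sigma] and [rho], this is at least
    [(rho^2 n / (2 e))^n].  Dividing the base by 4 leaves room for a factor
    [4^n] that absorbs those losses once [n] is large. *)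
Lemma signal_strength_lb n (t : 'I_n.+1) : (0 < t < n)%N ->
  sigma ^+ 2 * expR (2 * rho ^+ 2)^-1 * rho ^+ 2 / 2 <= n%:R ->
  (rho ^+ 2 / (8 * expR 1) * n%:R) ^+ n <= quad (invmx (S n)) (zeta R t) (zeta R t).
Proof.
case: n t => [t|m t] /andP[t0 tm] n_large; first by rewrite ltn0 in tm.
set q := quad _ _ _.
pose D := sigma ^+ 2 * expR (2 * rho ^+ 2)^-1; pose c := 2 / rho ^+ 2.
have c0 : 0 < c by rewrite divr_gt0// exprn_gt0.
have D0 : 0 < D by rewrite mulr_gt0 ?exprn_gt0 ?expR_gt0.
have f0 : 0 < m`!%:R :> R by rewrite ltr0n fact_gt0.
have cm0 : 0 < c ^+ m by rewrite exprn_gt0.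
have Ss := cov_matrix_sym sigma rho m.+1.
have Sge v : 0 <= quad (S m.+1) v v by exact: quad_cov_ge0.
have Spd v : quad (S m.+1) v v = 0 -> v = 0 by exact: quad_cov_eq0.
have q0 : 0 <= q by rewrite /q (quad_invmx Ss Spd).
have q_lb : 4 * m`!%:R <= D * c ^+ m * q.
  have := quad_invmx_ge Ss Sge Spd (zeta R t) (alt_vec m).
  have le4 : 4 <= ((alt_vec m)^T *m zeta R t) 0 0 ^+ 2.
    by apply: alt_vec_dot_zeta; rewrite t0.
  move=> /(le_trans le4) h; rewrite -ler_pdivlMr//; apply: (le_trans h).
  rewrite -/q mulrAC ler_wpM2r//; apply: le_trans (quad_cov_alt_vec _ rho0 m) _.
  by rewrite /D /c !mulrA.
have -> : rho ^+ 2 / (8 * expR 1) * m.+1%:R = m.+1%:R / (4 * c * expR 1).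
  by rewrite /c; field; rewrite !gt_eqF ?expR_gt0.
have ce0 : 0 < 4 * c * expR 1 by rewrite pmulr_rgt0 ?expR_gt0// pmulr_rgt0.
rewrite expr_div_n ler_pdivrMr ?exprn_gt0//.
apply: le_trans (natXn_le_fact_exp _) _.
rewrite exprMn mulrA ler_pM2r ?exprn_gt0 ?expR_gt0//.
rewrite -(ler_pM2l D0).
apply: (@le_trans _ _ (m`!%:R * c * (4 * 4 ^+ m.+1))).
  rewrite factS natrM [leLHS]mulrA [leLHS]mulrC -[leRHS]mulrA ler_pM2l//.
  have -> : D = c * (D / c) by rewrite mulrC divfK// gt_eqF.
  rewrite -[leLHS]mulrA ler_pM2l//.
  have Dc : D / c <= m.+1%:R.
    apply: le_trans n_large; rewrite /D /c le_eqVlt; apply/orP; left; apply/eqP.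
    by field; rewrite gt_eqF.
  apply: (@le_trans _ _ (m.+1%:R * m.+1%:R)); first by rewrite ler_wpM2r.
  rewrite -natrM -natrX -natrM ler_nat (leq_trans (sqr_le_exp4 m.+1))//.
  by rewrite leq_pmull.
rewrite exprMn [c ^+ m.+1]exprS.
have : 0 <= c * 4 ^+ m.+1 by rewrite mulr_ge0 ?exprn_ge0 ?ltW.
set k := 4 ^+ m.+1; set g := m`!%:R in q_lb *; set cm := c ^+ m in q_lb *.
by move=> ck; have := ler_wpM2l ck q_lb; congr (_ <= _); ring.
Qed.

End signal_strength.

(** * Moment generating function of the normal law *)

Section normal_integral.
Context {R : realType}.
Variables (m s : R).
Local Notation mu := (@lebesgue_measure R).
Import HBNNSimple.

Let mpdf : measurable_fun setT (EFin \o normal_pdf m s).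
Proof. by apply/measurable_EFinP; exact: measurable_normal_pdf. Qed.

Let pdf0 x : (0 <= (normal_pdf m s x)%:E)%E.
Proof. by rewrite lee_fin normal_pdf_ge0. Qed.

Let integral_normal_prob_nnsfun (f : {nnsfun measurableTypeR R >-> R}) :
  (\int[normal_prob m s]_x (f x)%:E =
   \int[mu]_x ((f x)%:E * (normal_pdf m s x)%:E))%E.
Proof.
under [LHS]eq_integral do rewrite fimfunE -fsumEFin//.
rewrite [LHS]ge0_integral_fsum//; last 2 first.
  - by move=> r; apply/measurable_EFinP; apply: measurable_funM.
  - by move=> n x _; rewrite EFinM nnfun_muleindic_ge0.
under [RHS]eq_integral.
  move=> x xD; rewrite fimfunE -fsumEFin// muleC ge0_mule_fsumr; last first.
    by move=> r; rewrite EFinM nnfun_muleindic_ge0.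
  over.
rewrite [RHS]ge0_integral_fsum//; last 2 first.
  - by move=> r; apply: emeasurable_funM => //;
      apply/measurable_EFinP; do 2 apply/measurableT_comp => //.
  - by move=> n x _; rewrite mule_ge0//; rewrite nnfun_muleindic_ge0.
apply: eq_fsbigr => r _.
rewrite integralZl_indic_nnsfun//= integral_indic//= setIT.
under [RHS]eq_integral do rewrite EFinM muleCA.
have [r0|r0] := leP 0 r; last first.
  have -> : f @^-1` [set r] = set0 by rewrite preimage_nnfun0.
  rewrite measure0 mule0 integral0_eq// => x _.
  by rewrite indic0 !mule0.
rewrite ge0_integralZl//.
- congr (_ * _)%E.
  by rewrite /normal_prob/= [LHS]integral_mkcond epatch_indic.
- by apply: emeasurable_funM => //; exact/measurable_EFinP.
- by move=> x _; rewrite mule_ge0// lee_fin.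
Qed.

(** Integration against a law with a density, by approximation with simple
    functions; the exponential moments below are integrals of this kind. *)
Lemma ge0_integral_normal_prob (f : measurableTypeR R -> \bar R) :
  measurable_fun setT f -> (forall x, 0 <= f x)%E ->
  (\int[normal_prob m s]_x f x = \int[mu]_x (f x * (normal_pdf m s x)%:E))%E.
Proof.
move=> mf f0.
pose f_ := nnsfun_approx measurableT mf.
transitivity (lim (\int[normal_prob m s]_x (f_ n x)%:E @[n --> \oo])%E).
  rewrite -monotone_convergence//=.
  - apply: eq_integral => ? /[!inE] xD; apply/esym/cvg_lim => //=.
    exact: cvg_nnsfun_approx.
  - by move=> n; exact/measurable_EFinP/measurable_funTS.
  - by move=> n ? _; rewrite lee_fin.
  - by move=> ? _ ? ? mn; rewrite lee_fin; exact/lefP/nd_nnsfun_approx.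
transitivity (lim (\int[mu]_x
    ((f_ n x)%:E * (normal_pdf m s x)%:E) @[n --> \oo])%E).
  by apply: congr_lim; apply/funext => n /=; exact: integral_normal_prob_nnsfun.
rewrite -monotone_convergence//=.
- apply: eq_integral => x _; apply/cvg_lim => //=.
  by apply: cvgeZr => //; exact: cvg_nnsfun_approx.
- by move=> n; apply: emeasurable_funM => //; exact/measurable_EFinP/measurable_funTS.
- by move=> n x _; rewrite mule_ge0// lee_fin.
- move=> x _ i j ij; rewrite lee_wpmul2r// lee_fin.
  exact/lefP/nd_nnsfun_approx.
Qed.

(** Completing the square: [exp (t (x - m))] times the density of mean [m] is a
    constant multiple of the density of mean [m + t s^2], whose integral is 1. *)
Lemma normal_prob_mgf t : s != 0 ->
  (\int[normal_prob m s]_x (expR (t * (x - m)))%:E =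
   (expR (t ^+ 2 * s ^+ 2 / 2))%:E)%E.
Proof.
move=> s0; rewrite ge0_integral_normal_prob; last 2 first.
- apply/measurable_EFinP; apply: measurableT_comp => //.
  by apply: measurable_funM => //; exact: measurable_funB.
- by move=> x; rewrite lee_fin expR_ge0.
transitivity (\int[mu]_x ((expR (t ^+ 2 * s ^+ 2 / 2))%:E *
    (normal_pdf (m + t * s ^+ 2) s x)%:E))%E.
  apply: eq_integral => x _; rewrite -!EFinM !normal_pdfE// /normal_fun.
  congr (_%:E); rewrite mulrCA [RHS]mulrCA -!expRD; congr (_ * expR _).
  by rewrite -mulr_natr; field.
rewrite ge0_integralZl//= ?lee_fin ?expR_ge0//.
- by rewrite integral_normal_pdf mule1.
- by apply/measurable_EFinP; exact: measurable_normal_pdf.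
- by move=> x _; rewrite lee_fin normal_pdf_ge0.
Qed.

End normal_integral.

Section gaussian_variable.
Context {R : realType} {d : measure_display} {Omega : measurableType d}.
Variable P : probability Omega R.

(** The formula covers the point mass [s = 0] too, so that later arguments need
    not distinguish degenerate laws. *)
Lemma gaussian_law_mgf (Y : {mfun Omega >-> R}) (m s t : R) :
  (forall A, measurable A -> pushforward P Y A = gaussian_law m s A) ->
  (\int[P]_w (expR (t * (Y w - m)))%:E = (expR (t ^+ 2 * s ^+ 2 / 2))%:E)%E.
Proof.
move=> lawY.
have mf : measurable_fun [set: measurableTypeR R]
    (fun y => (expR (t * (y - m)))%:E).
  apply/measurable_EFinP; apply: measurableT_comp => //.
  by apply: measurable_funM => //; exact: measurable_funB.
have mY : measurable_fun setT (Y : Omega -> measurableTypeR R).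
  exact: (@measurable_funPT _ _ _ _ Y).
pose Y' : {mfun Omega >-> measurableTypeR R} :=
  HB.pack (Y : Omega -> measurableTypeR R) (isMeasurableFun.Build _ _ _ _ _ mY).
rewrite -(@ge0_integral_distribution _ _ _ _ _ P Y' _ mf); last first.
  by move=> y; rewrite lee_fin expR_ge0.
have [s0|s0] := eqVneq s 0.
  transitivity (\int[\d_(m : measurableTypeR R)]_y (expR (t * (y - m)))%:E)%E.
    apply: eq_measure_integral => A mA _.
    by have := lawY A mA; rewrite /gaussian_law s0 eqxx.
  rewrite integral_dirac// diracT mul1e subrr mulr0 s0.
  by rewrite expr0n mulr0 mul0r.
rewrite -(normal_prob_mgf m t s0). apply: eq_measure_integral => A mA _.
by have := lawY A mA; rewrite /gaussian_law (negbTE s0).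
Qed.

Section gaussian_mgf.
Variables (Z : {mfun Omega >-> R}) (v : R).
Hypothesis v0 : 0 <= v.
Hypothesis mgfZ : forall t,
  (\int[P]_w (expR (t * Z w))%:E = (expR (t ^+ 2 * v / 2))%:E)%E.

Let mexp t : measurable_fun setT (fun w => expR (t * Z w)).
Proof. by apply: measurableT_comp => //; exact: measurable_funM. Qed.

Let exp_Lfun t : (fun w => expR (t * Z w)) \in Lfun P 1.
Proof.
apply/Lfun1_integrable/integrableP; split; first exact/measurable_EFinP.
under eq_integral do rewrite /= ger0_norm ?expR_ge0//.
by rewrite mgfZ ltry.
Qed.

Let E_exp t : ('E_P[fun w => expR (t * Z w)])%E = (expR (t ^+ 2 * v / 2))%:E.
Proof. by rewrite unlock. Qed.

Let sqr_le_exp (x : R) : x ^+ 2 <= 2 * (expR x + expR (- x)).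
Proof.
have e0 y := @expR_ge0 R y.
have h (y : R) : 0 <= y -> y ^+ 2 <= 2 * (expR y).
  move=> y0; have := @exp_partial_sum_le R y 3 y0.
  rewrite !big_ord_recr big_ord0/= add0r -[2`!]/2%N -[1`!]/1%N -[0`!]/1%N.
  by rewrite expr0 expr1 !divr1; set a := y ^+ 2; lra.
have [x0|x0] := leP 0 x.
  by apply: le_trans (h x x0) _; have := e0 (- x); lra.
rewrite -sqrrN; apply: le_trans (h (- x) _) _; first by lra.
by have := e0 x; lra.
Qed.

Lemma gaussian_mgf_Lfun2 : (Z : Omega -> R) \in Lfun P 2%:E.
Proof.
rewrite inE; apply/andP; split; rewrite inE//=.
rewrite /finite_norm unlock poweR_lty//.
under eq_integral do rewrite /= powR_mulrn//  real_normK ?num_real//.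
apply: (@le_lt_trans _ _ (\int[P]_w (2 * (expR (1 * Z w) + expR (-1 * Z w)))%:E)%E).
  apply: ge0_le_integral => //=.
  - by move=> w _; rewrite lee_fin sqr_ge0.
  - by apply/measurable_EFinP; exact: measurable_funX.
  - by apply/measurable_EFinP; apply: measurable_funM => //; exact: measurable_funD.
  - by move=> w _; rewrite lee_fin mul1r mulN1r.
have e1 := exp_Lfun 1; have e2 := exp_Lfun (-1).
have e12 : ((fun w => expR (1 * Z w)) \+ (fun w => expR (-1 * Z w))) \in Lfun P 1.
  exact: rpredD.
under eq_integral do rewrite mulrC.
have := integrable_lty measurableT
  (proj1 (Lfun1_integrable _ _) (Lfun_scale 2 (lexx 1) e12)).
exact.
Qed.

Let Z2 := gaussian_mgf_Lfun2.
Let Z1 : (Z : Omega -> R) \in Lfun P 1.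
Proof. by apply: Lfun_subset12 Z2; exact: fin_num_measure. Qed.

Let EZ := fine ('E_P[Z])%E.
Let EZE : ('E_P[Z])%E = EZ%:E.
Proof. by rewrite fineK// expectation_fin_num. Qed.

Let expectation_leL (f g : Omega -> R) : f \in Lfun P 1 -> g \in Lfun P 1 ->
  (forall w, f w <= g w) -> ('E_P[f] <= 'E_P[g])%E.
Proof.
move=> fL gL fg; rewrite unlock; apply: le_integral => //.
- exact/Lfun1_integrable.
- exact/Lfun1_integrable.
- by move=> w _; rewrite lee_fin.
Qed.

(** From [1 + t x <= exp (t x)] comes [1 + t E Z <= exp (t^2 v / 2)] for all [t];
    as the right side is [1 + O(t^2)], letting [t] tend to 0 with the sign of
    [E Z] forces [E Z = 0]. *)
Lemma gaussian_mgf_mean : ('E_P[Z])%E = 0%E.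
Proof.
have key t : 1 + t * EZ <= expR (t ^+ 2 * v / 2).
  rewrite -lee_fin -E_exp.
  have -> : (1 + t * EZ)%:E = ('E_P[(cst 1 \+ (t \o* Z))%R])%E.
    by rewrite expectationD ?Lfun_cst ?Lfun_scale// expectation_cst expectationZl// EZE.
  apply: expectation_leL => //; first by rewrite rpredD ?Lfun_cst ?Lfun_scale.
  by move=> w; rewrite /= mulrC expR_ge1Dx.
rewrite EZE; congr (_%:E); move: (EZ) key => e key.
apply/eqP/negP => /negP E0.
(* Contradiction at [t = e / D]; dividing by [D] makes both [e^2 / D] and
   [v / D] smaller than 1, in fact their sum. *)
pose D := 1 + v + e ^+ 2.
have E2 : 0 < e ^+ 2 by rewrite exprn_even_gt0.
have vge0 := v0; have D0 : 0 < D by rewrite /D; lra.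
have kD : (1 + e ^+ 2 / D) * (1 - e ^+ 2 / D ^+ 2 * v / 2) <= 1.
  have := key (e / D); rewrite (mulrAC e) -expr2 expr_div_n => h.
  set u := e ^+ 2 / D ^+ 2 * v / 2 in h *.
  have eu : expR u * expR (- u) = 1 by rewrite expRxMexpNx_1.
  have ge : 1 - u <= expR (- u) by have := expR_ge1Dx (- u).
  rewrite -[leRHS]eu; apply: (@le_trans _ _ ((1 + e ^+ 2 / D) * expR (- u))).
    by rewrite ler_wpM2l// addr_ge0// divr_ge0 ?sqr_ge0// ltW.
  by rewrite ler_wpM2r ?expR_ge0.
move: kD; pose a := e ^+ 2 / D; pose c := v / D.
have -> : e ^+ 2 / D ^+ 2 * v / 2 = a * c / 2.
  by rewrite /a /c; field; rewrite gt_eqF.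
rewrite -/a => kD.
have a0 : 0 < a by rewrite divr_gt0.
have c0 : 0 <= c by rewrite divr_ge0// ltW.
have ac1 : a + c < 1.
  by rewrite /a /c -mulrDl ltr_pdivrMr// mul1r /D; lra.
have : 0 < a * (1 - c / 2 - a * c / 2) by rewrite mulr_gt0//; nra.
by nra.
Qed.

Let ZZ1 : ((Z : Omega -> R) ^+ 2) \in Lfun P 1.
Proof. exact: Lfun2_mul_Lfun1. Qed.

(* The cubic error has an expectation that is finite and independent of [t],
   which is what the comparison of second order terms needs. *)
Let exp_taylor2 (t x : R) : 0 < t <= 1 ->
  expR (t * x) <= 1 + t * x + t ^+ 2 / 2 * x ^+ 2 +
    t ^+ 3 * (expR (2 * x) + expR (-2 * x)).
Proof.
move=> /andP[t0 t1].
have := exp_taylor_remainder (t * x) 3.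
rewrite !big_ord_recr big_ord0/= add0r -[2`!]/2%N -[1`!]/1%N -[0`!]/1%N.
rewrite expr0 expr1 !divr1 => /(le_trans (ler_norm _)).
rewrite lerBlDl => h; apply: (le_trans h).
rewrite [(t * x) ^+ 2]exprMn (mulrAC (t ^+ 2)).
rewrite lerD2l normrM (gtr0_norm t0) exprMn.
rewrite -(mulrA _ (`|x| ^+ 3)) -(mulrA _ (`|x| ^+ 3 / _)).
rewrite ler_wpM2l ?exprn_ge0 ?(ltW t0)//.
apply: (@le_trans _ _ (expR `|x| * expR `|x|)).
  rewrite ler_pM ?divr_ge0 ?exprn_ge0 ?expR_ge0//.
    have := @exp_partial_sum_le R `|x| 4 (normr_ge0 _).
    by apply: le_trans; rewrite big_ord_recr/= lerDr sumr_ge0.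
  by rewrite ler_expR ler_piMl.
rewrite -expRD (_ : `|x| + `|x| = 2 * `|x|); last by rewrite mulr_natl mulr2n.
have -> : -2 * x = 2 * - x by rewrite mulrN mulNr.
by case: (ger0P x) => _; rewrite ?lerDl ?lerDr expR_ge0.
Qed.

(** Through this inequality a bound on the variance controls the parameter [v],
    which governs the tail.  Compare the terms in [t^2] of
    [1 + t^2 v / 2 <= E (exp (t Z)) <= 1 + t^2 V / 2 + O(t^3)] as [t] tends to 0. *)
Lemma gaussian_mgf_variance : (v%:E <= 'V_P[Z])%E.
Proof.
have VZ : ('V_P[Z] = 'E_P[((Z : Omega -> R) ^+ 2)%R])%E.
  by rewrite varianceE// gaussian_mgf_mean expe2 mule0 sube0.
have Vfin : ('E_P[((Z : Omega -> R) ^+ 2)%R])%E \is a fin_num.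
  exact: expectation_fin_num.
rewrite VZ -(fineK Vfin) lee_fin; set V := fine _.
pose K := 2 * expR (2 ^+ 2 * v / 2).
have K0 : 0 < K by rewrite mulr_gt0 ?expR_gt0.
have key t : 0 < t <= 1 -> v <= V + 2 * K * t.
  move=> t01; have /andP[t0 t1] := t01.
  have : 1 + t ^+ 2 * v / 2 <= 1 + t ^+ 2 / 2 * V + t ^+ 3 * K.
    apply: (le_trans (expR_ge1Dx _)); rewrite -lee_fin -E_exp.
    pose f1 : Omega -> R := cst 1 \+ (t \o* Z).
    pose f2 : Omega -> R := (t ^+ 2 / 2) \o* ((Z : Omega -> R) ^+ 2).
    pose f3 : Omega -> R := (fun w => expR (2 * Z w)) \+ (fun w => expR (-2 * Z w)).
    have L1 : f1 \in Lfun P 1 by rewrite rpredD ?Lfun_cst ?Lfun_scale.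
    have L2 : f2 \in Lfun P 1 by rewrite Lfun_scale.
    have L3 : f3 \in Lfun P 1 by rewrite rpredD.
    have L12 : f1 \+ f2 \in Lfun P 1 by rewrite rpredD.
    have L3' : t ^+ 3 \o* f3 \in Lfun P 1 by rewrite Lfun_scale.
    have -> : (1 + t ^+ 2 / 2 * V + t ^+ 3 * K)%:E =
        ('E_P[(f1 \+ f2 \+ (t ^+ 3 \o* f3))%R])%E.
      have E1 : ('E_P[f1])%E = 1%E.
        rewrite expectationD ?Lfun_cst ?Lfun_scale// expectation_cst.
        by rewrite expectationZl// gaussian_mgf_mean mule0 adde0.
      have E2 : ('E_P[f2])%E = (t ^+ 2 / 2 * V)%:E.
        by rewrite expectationZl// -(fineK Vfin) -EFinM.
      have E3 : ('E_P[f3])%E = K%:E.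
        by rewrite expectationD// !E_exp sqrrN -EFinD /K mulr_natl mulr2n.
      rewrite (expectationD L12 L3') (expectationD L1 L2).
      by rewrite (expectationZl _ L3) E1 E2 E3.
    apply: expectation_leL => //.
      by rewrite rpredD ?Lfun_scale// rpredD.
    move=> w; apply: le_trans (exp_taylor2 (Z w) t01) _.
    by rewrite /f1 /f2 /f3 /= (mulrC t (Z w)) (mulrC (t ^+ 2 / 2)) (mulrC (t ^+ 3)).
  move=> h; have t20 : 0 < t ^+ 2 / 2 by rewrite divr_gt0 ?exprn_gt0.
  rewrite -(ler_pM2l t20); move: h; rewrite -lerBlDl; nra.
apply/ler_addgt0Pr => e e0.
pose t := Num.min 1 (e / (2 * K)).
have t01 : 0 < t <= 1.
  by rewrite /t lt_min ltr01 ge_min lexx divr_gt0// mulr_gt0.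
apply: (le_trans (key t t01)); rewrite lerD2l.
have K2 : 0 < 2 * K by rewrite pmulr_rgt0.
by rewrite mulrC -ler_pdivlMr// /t ge_min lexx orbT.
Qed.

(** Chernoff's bound with exponent [x], optimal for unit variance, for [Z] and
    for [- Z]. *)
Lemma gaussian_mgf_tail (x : R) : v <= 1 -> 0 < x ->
  (P [set w | (x <= `|Z w|)%R] <= (2 * expR (- (x ^+ 2 / 2)))%:E)%E.
Proof.
move=> v1 x0.
have half (U : {mfun Omega >-> R}) :
    (\int[P]_w (expR (x * U w))%:E = (expR (x ^+ 2 * v / 2))%:E)%E ->
    (P [set w | (x <= U w)%R] <= (expR (- (x ^+ 2 / 2)))%:E)%E.
  move=> mgfU; apply: le_trans (@chernoff _ _ _ P U x x x0) _.
  have -> : mmt_gen_fun P U x = (expR (x ^+ 2 * v / 2))%:E.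
    rewrite -mgfU /mmt_gen_fun unlock; apply: eq_integral => w _.
    by rewrite /= mulrC.
  rewrite -EFinM lee_fin -expRD ler_expR -expr2.
  by have := sqr_ge0 x; nra.
have mge (U : {mfun Omega >-> R}) : measurable [set w | x <= U w].
  rewrite [X in measurable X](_ : _ = U @^-1` `[x, +oo[).
    by rewrite -[X in measurable X]setTI; exact: measurable_funP.
  by apply/seteqP; split=> w /=; rewrite in_itv/= andbT.
have -> : [set w | x <= `|Z w|] =
    [set w | x <= Z w] `|` [set w | x <= (- Z : {mfun Omega >-> R}) w].
  by apply/seteqP; split => w /=; rewrite real_ler_normr ?num_real//; move/orP.
apply: le_trans (measureU2 _ (mge Z) (mge (- Z))) _.
rewrite mulr2n mulrDl mul1r EFinD leeD// half//.
transitivity (\int[P]_w (expR ((- x) * Z w))%:E)%E.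
  by apply: eq_integral => w _; rewrite /= mulrN mulNr.
by rewrite mgfZ sqrrN.
Qed.
End gaussian_mgf.
End gaussian_variable.

(** * Linear statistics of the observations *)

Section linear_statistics.
Context {R : realType} {d : measure_display} {Omega : measurableType d}.
Variable P : probability Omega R.

Lemma Lfun2D (f g : Omega -> R) : f \in Lfun P 2%:E -> g \in Lfun P 2%:E ->
  f \+ g \in Lfun P 2%:E.
Proof.
have p12 : (1 <= 2%:E :> \bar R)%E by rewrite lee_fin ler1n.
exact: (Lfun_addr_closed P p12).2.
Qed.

Lemma Lfun2_sum I (r : seq I) (f : I -> Omega -> R) :
  (forall i, f i \in Lfun P 2%:E) -> \sum_(i <- r) f i \in Lfun P 2%:E.
Proof.
move=> f2; elim/big_rec : _ => [|i g _ g2]; first exact: (Lfun_cst P 0).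
exact: Lfun2D.
Qed.

Section one_variable.
Variables (Y : {mfun Omega >-> R}) (m s : R).
Hypothesis lawY :
  forall A, measurable A -> pushforward P Y A = gaussian_law m s A.

Let Zf : Omega -> R := fun w => Y w - m.
Let mZ : measurable_fun setT Zf. Proof. exact: measurable_funB. Qed.
Let Z : {mfun Omega >-> R} := HB.pack Zf (isMeasurableFun.Build _ _ _ _ _ mZ).

Let mgfZ t : (\int[P]_w (expR (t * Z w))%:E = (expR (t ^+ 2 * s ^+ 2 / 2))%:E)%E.
Proof. exact: gaussian_law_mgf. Qed.

Let YE : (Y : Omega -> R) = (Z : Omega -> R) \+ cst m.
Proof. by apply/funext => w /=; rewrite subrK. Qed.

Let Z2 : (Z : Omega -> R) \in Lfun P 2%:E.
Proof. exact: gaussian_mgf_Lfun2 mgfZ. Qed.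

Lemma gaussian_Lfun2 : (Y : Omega -> R) \in Lfun P 2%:E.
Proof. by rewrite YE Lfun2D// Lfun_cst. Qed.

Lemma gaussian_mean : ('E_P[Y] = m%:E)%E.
Proof.
rewrite YE expectationD ?Lfun_cst//; last first.
  by apply: Lfun_subset12 Z2; exact: fin_num_measure.
by rewrite (gaussian_mgf_mean (sqr_ge0 s) mgfZ) expectation_cst add0e.
Qed.

Lemma gaussian_variance_ge : ((s ^+ 2)%:E <= 'V_P[Y])%E.
Proof.
rewrite YE varianceD_cst_r//.
exact: (gaussian_mgf_variance (sqr_ge0 s) mgfZ).
Qed.

Lemma gaussian_tail (x : R) : ('V_P[Y] <= 1)%E -> 0 < x ->
  (P [set w | (x <= `|Y w - m|)%R] <= (2 * expR (- (x ^+ 2 / 2)))%:E)%E.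
Proof.
move=> V1; apply: (gaussian_mgf_tail mgfZ).
by rewrite -lee_fin; exact: le_trans gaussian_variance_ge V1.
Qed.

End one_variable.

Lemma covariance_suml I (r : seq I) (f : I -> Omega -> R) (Y : Omega -> R) :
  (forall i, f i \in Lfun P 2%:E) -> Y \in Lfun P 2%:E ->
  (covariance P (\sum_(i <- r) f i)%R Y = \sum_(i <- r) covariance P (f i) Y)%E.
Proof.
move=> f2 Y2; elim: r => [|i r IH].
  by rewrite !big_nil; exact: covariance_cst_l.
by rewrite !big_cons covarianceDl// ?IH// Lfun2_sum.
Qed.

Lemma expectation_sumf I (r : seq I) (f : I -> Omega -> R) :
  (forall i, f i \in Lfun P 1) ->
  ('E_P[(\sum_(i <- r) f i)%R] = \sum_(i <- r) 'E_P[f i])%E.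
Proof.
move=> f1; elim: r => [|i r IH].
  by rewrite !big_nil; exact: expectation_cst.
by rewrite !big_cons expectationD// ?IH// rpred_sum.
Qed.

Variables (G : R -> {mfun Omega >-> R}) (K : R -> R) (n : nat) (m : 'cV[R]_n).
Hypothesis model : observation_model P G K m.

Let u (k : 'I_n) : R := k.+1%:R / n%:R.

Let u01 k : 0 <= u k <= 1.
Proof.
have n0 : 0 < n%:R :> R by rewrite ltr0n (leq_ltn_trans _ (ltn_ord k)).
by rewrite divr_ge0//= ler_pdivrMr// mul1r ler_nat.
Qed.

Let G2 k : (G (u k) : Omega -> R) \in Lfun P 2%:E.
Proof.
have [gp _ _] := model.
have [mu [s [_ law]]] := gp 1%N (fun=> 1) (fun=> u k) (fun=> u01 k).
apply: (@gaussian_Lfun2 _ mu s) => A mA; rewrite -law//.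
by congr (pushforward P _ A); apply/funext => w; rewrite big_ord1 mul1r.
Qed.

Let G1 k : (G (u k) : Omega -> R) \in Lfun P 1.
Proof. by apply: Lfun_subset12 (G2 k); exact: fin_num_measure. Qed.

Variable c : 'cV[R]_n.

Definition linear_statistic (w : Omega) : R := (c^T *m observation G n w) 0 0.

Let Yf : Omega -> R := \sum_(k < n) (c k 0 \o* (G (u k) : Omega -> R)).

Let YfE : linear_statistic = Yf.
Proof.
apply/funext => w; rewrite /linear_statistic mxE /Yf fct_sumE.
by apply: eq_bigr => k _; rewrite !mxE /= mulrC.
Qed.

Lemma measurable_linear_statistic : measurable_fun setT linear_statistic.
Proof.
rewrite YfE /Yf; apply: (big_ind (fun f : Omega -> R => measurable_fun setT f)) => //.
- exact: measurable_cst.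
- by move=> f g; exact: measurable_funD.
Qed.

Lemma linear_statistic_mean : ('E_P[linear_statistic] = ((c^T *m m) 0 0)%:E)%E.
Proof.
have [_ _ mean] := model.
rewrite YfE /Yf expectation_sumf; last by move=> k; rewrite Lfun_scale.
rewrite mxE -sumEFin; apply: eq_bigr => k _.
rewrite expectationZl// mxE EFinM -mean; congr (_ * 'E_P[_])%E.
by apply/funext => w; rewrite mxE.
Qed.

Lemma linear_statistic_variance :
  ('V_P[linear_statistic] = (quad (cov_matrix K n) c c)%:E)%E.
Proof.
have [_ cov _] := model.
have s2 k : c k 0 \o* (G (u k) : Omega -> R) \in Lfun P 2%:E.
  by rewrite Lfun_scale// ler1n.
have s1 k : c k 0 \o* (G (u k) : Omega -> R) \in Lfun P 1 by rewrite Lfun_scale.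
rewrite /variance YfE /Yf covariance_suml ?Lfun2_sum// quadE -sumEFin.
apply: eq_bigr => r _; rewrite covarianceC covariance_suml// -sumEFin.
apply: eq_bigr => s _; rewrite covarianceC.
rewrite covarianceZl//; last exact: Lfun2_mul_Lfun1.
rewrite covarianceZr//; last exact: Lfun2_mul_Lfun1.
rewrite cov// mxE -!EFinM mulrA; congr (_ * K _)%:E.
by rewrite /u -mulrBl -!natr1 opprD addrACA subrr addr0.
Qed.

(** Gaussianity of the process provides a normal law with unknown parameters for
    the linear statistic; its mean and variance, computed from those of the
    process, pin them down well enough for the tail bound. *)
Lemma linear_statistic_tail (x : R) : quad (cov_matrix K n) c c = 1 -> 0 < x ->
  (P [set w | (x <= `|linear_statistic w - (c^T *m m) 0 0|)%R] <=
    (2 * expR (- (x ^+ 2 / 2)))%:E)%E.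
Proof.
move=> V1 x0; have [gp _ _] := model.
have [mu [s [_ law]]] := gp n (fun k => c k 0) u u01.
pose Y : {mfun Omega >-> R} := HB.pack linear_statistic
  (isMeasurableFun.Build _ _ _ _ _ measurable_linear_statistic).
have lawY A : measurable A -> pushforward P Y A = gaussian_law mu s A.
  move=> mA; rewrite -law//; congr (pushforward P _ A); apply/funext => w.
  by rewrite /= /linear_statistic mxE; apply: eq_bigr => k _; rewrite !mxE.
have muE : mu = (c^T *m m) 0 0.
  by have := gaussian_mean lawY; rewrite linear_statistic_mean => -[].
rewrite -muE; apply: (gaussian_tail lawY) => //.
by rewrite linear_statistic_variance V1.
Qed.

End linear_statistics.

(** * Error probabilities of the generalized likelihood ratio test *)

Lemma measure_bigsetU_le (d : measure_display) (T : measurableType d) (R : realType)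
    (mu : {measure set T -> \bar R}) (I : Type) (r : seq I) (Q : pred I)
    (A : I -> set T) : (forall i, measurable (A i)) ->
  (mu (\big[setU/set0]_(i <- r | Q i) A i) <= \sum_(i <- r | Q i) mu (A i))%E.
Proof.
move=> mA; elim: r => [|i r IH]; first by rewrite !big_nil measure0.
rewrite !big_cons; case: ifP => // _.
apply: le_trans (measureU2 _ _ _) _ => //; first exact: bigsetU_measurable.
exact: leeD2l.
Qed.

Section glrt.
Context {R : realType}.

(** The value [2 log (8 (n + 1) / delta)] makes each of the at most [n + 1] tail
    probabilities at most [delta / (4 (n + 1))].  The default value 1 keeps the
    threshold positive outside the range [0 < delta < 1]. *)
Definition glrt_threshold (n : nat) (delta : R) : R :=
  let T := 2 * ln (8 * n.+1%:R / delta) in if 0 < T then T else 1.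

Lemma glrt_threshold_gt0 n delta : 0 < glrt_threshold n delta.
Proof. by rewrite /glrt_threshold; case: ifP. Qed.

Lemma glrt_thresholdE n delta : 0 < delta < 1 ->
  glrt_threshold n delta = 2 * ln (8 * n.+1%:R / delta).
Proof.
move=> /andP[d0 d1]; rewrite /glrt_threshold ifT// mulr_gt0// ln_gt0//.
rewrite ltr_pdivlMr// mul1r (lt_trans d1)//.
by have : 1 <= n.+1%:R :> R; [rewrite ler1n | lra].
Qed.

Lemma glrt_threshold_tail n delta : 0 < delta < 1 ->
  2 * expR (- (Num.sqrt (glrt_threshold n delta) ^+ 2 / 2)) =
  delta / 4 / n.+1%:R.
Proof.
move=> d01; have /andP[d0 d1] := d01.
rewrite sqr_sqrtr ?ltW ?glrt_threshold_gt0// glrt_thresholdE//.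
rewrite mulrAC divff// mul1r expRN lnK ?posrE ?divr_gt0 ?mulr_gt0//.
have := ltr0Sn R n; move: (n.+1%:R : R) => N N0.
by field; rewrite !gt_eqF.
Qed.

Variables (sigma rho alpha : R).
Hypotheses (sigma0 : 0 < sigma) (rho0 : 0 < rho) (alpha0 : 0 < alpha).
Variable n : nat.
Local Notation K := (gaussian_kernel sigma rho).
Local Notation S := (cov_matrix K n).

Lemma change_points_range (t : 'I_n.+1) :
  t \in change_points n alpha -> (0 < t < n)%N.
Proof.
rewrite inE => /andP[t0 tn]; rewrite t0/= -subn_gt0 -(ltr_nat R).
apply: le_lt_trans (lt_le_trans tn _); first by rewrite mulr_ge0// ltW.
by rewrite ler_nat geq_minr.
Qed.

(** The squared signal-to-noise ratio for a jump of size 2 at [t]. *)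
Definition signal (t : 'I_n.+1) : R := quad (invmx S) (zeta R t) (zeta R t).

(** Normalization makes the statistic [(glrt_weights t)^T X] of unit variance. *)
Definition glrt_weights (t : 'I_n.+1) : 'cV[R]_n :=
  (Num.sqrt (signal t))^-1 *: (invmx S *m zeta R t).

Lemma signal_gt0 t : (0 < n)%N -> 0 < signal t.
Proof.
move=> n0; apply: quad_invmx_gt0.
- exact: cov_matrix_sym.
- by move=> v; exact: quad_cov_ge0.
- by move=> v; exact: quad_cov_eq0.
apply/eqP => /matrixP /(_ (Ordinal n0) 0); rewrite !mxE => /eqP.
by case: ifP => _; rewrite ?oppr_eq0 oner_eq0.
Qed.

Lemma glrt_weights_trE t (x : 'cV[R]_n) :
  ((glrt_weights t)^T *m x) 0 0 =
  ((zeta R t)^T *m invmx S *m x) 0 0 / Num.sqrt (signal t).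
Proof.
rewrite /glrt_weights linearZ/= trmx_mul invmx_sym ?cov_matrix_sym//.
by rewrite -scalemxAl mxE mulrC.
Qed.

Lemma glrt_statisticE t (x : 'cV[R]_n) :
  glrt_statistic S t x = `|((glrt_weights t)^T *m x) 0 0| ^+ 2.
Proof. by rewrite glrt_weights_trE. Qed.

Lemma quad_glrt_weights t : (0 < n)%N -> quad S (glrt_weights t) (glrt_weights t) = 1.
Proof.
move=> n0; have q0 := signal_gt0 t n0.
rewrite /glrt_weights quadZl quad_sym ?cov_matrix_sym// quadZl.
rewrite -quad_invmx ?cov_matrix_sym//; last by move=> v; exact: quad_cov_eq0.
rewrite mulrA -expr2 exprVn sqr_sqrtr ?ltW// mulVf// gt_eqF//.
Qed.

Lemma glrt_weights_mean t (b : R) : (0 < n)%N ->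
  ((glrt_weights t)^T *m (b / 2 *: zeta R t)) 0 0 = b / 2 * Num.sqrt (signal t).
Proof.
move=> n0; have q0 := signal_gt0 t n0.
have qE : signal t / Num.sqrt (signal t) = Num.sqrt (signal t).
  by rewrite -[X in X / _](sqr_sqrtr (ltW q0)) expr2 mulfK// gt_eqF// sqrtr_gt0.
by rewrite glrt_weights_trE -scalemxAr mxE -/(quad _ _ _) -/(signal t) -!mulrA qE.
Qed.

Variables (d : measure_display) (Omega : measurableType d).
Variable G : R -> {mfun Omega >-> R}.
Local Notation X := (observation G n).

Variable thr : R.
Hypothesis thr0 : 0 < thr.
Local Notation x := (Num.sqrt thr).

Let x0 : 0 < x. Proof. by rewrite sqrtr_gt0. Qed.

Let Y t := linear_statistic G (glrt_weights t).

Lemma stat_ge t w : (thr <= glrt_statistic S t (X w)) = (x <= `|Y t w|).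
Proof.
rewrite glrt_statisticE -{1}(sqr_sqrtr (ltW thr0)).
by rewrite ler_pXn2r// ?nnegrE ?normr_ge0 ?sqrtr_ge0.
Qed.

Lemma glrt_rejectE : [set w | glrt S alpha thr (X w)] =
  \big[setU/set0]_(t in change_points n alpha) [set w | x <= `|Y t w|].
Proof.
rewrite -bigcup_pred; apply/seteqP; split => w /=.
  by case/bigmax_geP => [|[t tc]]; [rewrite leNgt thr0|rewrite stat_ge; exists t].
by case=> t /= tc xY; apply/bigmax_geP; right; exists t => //; rewrite stat_ge.
Qed.

Let mY t : measurable_fun setT (Y t).
Proof. exact: measurable_linear_statistic. Qed.

Let mreject t : measurable [set w | x <= `|Y t w|].
Proof.
rewrite [X in measurable X](_ : _ = (Num.norm \o Y t) @^-1` `[x, +oo[).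
  by rewrite -[X in measurable X]setTI; apply: measurableT_comp.
by apply/seteqP; split=> w /=; rewrite in_itv/= andbT.
Qed.

Let mglrt : measurable [set w | glrt S alpha thr (X w)].
Proof. by rewrite glrt_rejectE; apply: bigsetU_measurable. Qed.

(** Union bound over the change points, whose number is at most [n + 1]. *)
Lemma glrt_false_alarm (P0 : probability Omega R) : (0 < n)%N ->
  observation_model P0 G K (0 : 'cV[R]_n) ->
  (P0 [set w | glrt S alpha thr (X w)] <=
   (n.+1%:R * (2 * expR (- (x ^+ 2 / 2))))%:E)%E.
Proof.
move=> n0 model; rewrite glrt_rejectE.
apply: le_trans (measure_bigsetU_le _ _ _ (fun t => mreject t)) _.
apply: (@le_trans _ _ (\sum_(t in change_points n alpha)
   (2 * expR (- (x ^+ 2 / 2)))%:E)%E).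
  apply: lee_sum => t _.
  have := linear_statistic_tail model (quad_glrt_weights t n0) x0.
  rewrite mulmx0 mxE; under eq_set do rewrite subr0.
  exact.
rewrite sumEFin lee_fin sumr_const [leRHS]mulr_natl ler_wpMn2l//.
by rewrite (leq_trans (max_card _))// card_ord.
Qed.

(** Accepting the null forces [|Y_t| < x] for the true change point.  The
    hypothesis says that the mean of [Y_t] is at least [2 x] in absolute value, so
    [Y_t] then deviates from its mean by at least [x]. *)
Lemma glrt_miss (P1 : probability Omega R) (b : R) t : (0 < n)%N ->
  t \in change_points n alpha ->
  observation_model P1 G K (b / 2 *: zeta R t) ->
  16 * thr <= b ^+ 2 * signal t ->
  (P1 [set w | ~~ glrt S alpha thr (X w)] <=
   (2 * expR (- (x ^+ 2 / 2)))%:E)%E.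
Proof.
move=> n0 tc model strong.
have := linear_statistic_tail model (quad_glrt_weights t n0) x0.
rewrite glrt_weights_mean//; apply: le_trans.
apply: le_measure; rewrite ?inE.
- rewrite (_ : [set w | _] = ~` [set w | glrt S alpha thr (X w)]).
    exact: measurableC.
  by apply/seteqP; split=> w /= /negP.
- rewrite [X in measurable X](_ : _ =
    (fun w => `|Y t w - b / 2 * Num.sqrt (signal t)|) @^-1` `[x, +oo[).
    have mdist : measurable_fun setT
        (fun w => `|Y t w - b / 2 * Num.sqrt (signal t)|).
      by apply: measurableT_comp => //; exact: measurable_funB.
    by rewrite -[X in measurable X]setTI; exact: mdist.
  by apply/seteqP; split=> w /=; rewrite in_itv/= andbT.
- move=> w /= nrej.
  have small : `|Y t w| < x.
    rewrite ltNge -stat_ge; apply: contra nrej => st.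
    by apply/bigmax_geP; right; exists t.
  set mu := b / 2 * _.
  have large : 2 * x <= `|mu|.
    rewrite -(@ler_pXn2r _ 2)// ?nnegrE// ?mulr_ge0 ?sqrtr_ge0//.
    rewrite real_normK ?num_real// /mu !exprMn.
    rewrite !sqr_sqrtr ?(ltW thr0) ?(ltW (signal_gt0 t n0))//.
    by rewrite exprVn; lra.
  have := ler_distD (Y t w) 0 mu; rewrite !sub0r !normrN => tri.
  by rewrite -/(Y t w); lra.
Qed.

End glrt.

(** * The detection threshold *)

(** The size condition says [M^2 >= 8 n] for [M = n (1 - 2 alpha)], hence
    [8 (n + 1) / delta <= (M / delta)^4]: passing from [n + 1] to [n (1 - 2 alpha)]
    in the logarithm costs only a constant factor. *)
Lemma glrt_threshold_le_ln (R : realType) (alpha delta : R) n :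
  0 < alpha < 2^-1 -> 0 < delta < 1 -> 8 / (1 - 2 * alpha) ^+ 2 <= n%:R ->
  glrt_threshold n delta <= 8 * ln (n%:R * (1 - 2 * alpha) / delta).
Proof.
move=> /andP[a0 a1] d01 n_large; have /andP[d0 d1] := d01.
have a2 : 0 < 1 - 2 * alpha by lra.
have M2 : 8 <= n%:R * (1 - 2 * alpha) ^+ 2.
  by rewrite -ler_pdivrMr ?exprn_gt0.
have n1 : 1 <= n%:R :> R.
  by rewrite ler1n lt0n; apply/eqP => n0; move: M2; rewrite n0 mul0r; lra.
rewrite glrt_thresholdE//; set M := n%:R * (1 - 2 * alpha).
have MM : 8 * n%:R <= M ^+ 2.
  rewrite /M exprMn expr2 -mulrA mulrC ler_wpM2l//; exact: le_trans n1.
have M0 : 0 < M by rewrite mulr_gt0// (lt_le_trans ltr01).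
have Md0 : 0 < M / delta by rewrite divr_gt0.
have -> : 8 * ln (M / delta) = 2 * ln ((M / delta) ^+ 4).
  by rewrite lnXn// -[ln _ *+ 4]mulr_natl mulrA -natrM.
rewrite ler_pM2l// ler_ln ?posrE ?exprn_gt0// ?divr_gt0 ?mulr_gt0//.
rewrite expr_div_n ler_pdivrMr// mulrAC ler_pdivlMr ?exprn_gt0//.
have Nn : 8 * n.+1%:R <= M ^+ 4.
  rewrite -natr1 -[4%N]/(2 * 2)%N exprM; set Q := M ^+ 2 in MM *.
  by move: n1 MM; set k := n%:R; nra.
have d4 : delta ^+ 4 <= delta by rewrite -[leRHS]expr1 ler_wiXn2l ?(ltW d0) ?(ltW d1).
by rewrite ler_pM ?exprn_ge0 ?mulr_ge0 ?(ltW d0).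
Qed.

Theorem theorem3p2 (R : realType) :
  exists (C : R) (C0 : R -> R) (n0 : R -> R -> R -> nat)
         (thr : R -> nat -> R -> R),
    [/\ 0 < C,
        (forall rho : R, 0 < rho -> 0 < C0 rho),
        (forall (alpha : R) (n : nat) (delta : R), 0 < thr alpha n delta) &
        forall (rho sigma alpha delta : R),
          0 < rho -> 0 < sigma -> 0 < alpha < 2^-1 -> 0 < delta < 1 ->
        forall n : nat, (n0 rho sigma alpha <= n)%N ->
        forall b : R, b != 0 ->
          C * Num.sqrt (expR (- (n%:R * ln (C0 rho * n%:R))) *
                        ln (n%:R * (1 - 2 * alpha) / delta)) <= `|b| ->
        forall (d : measure_display) (Omega : measurableType d)
               (G : R -> {mfun Omega >-> R})
               (P0 : probability Omega R)
               (P1 : 'I_n.+1 -> probability Omega R),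
          observation_model P0 G (gaussian_kernel sigma rho) (0 : 'cV[R]_n) ->
          (forall t : 'I_n.+1, t \in change_points n alpha ->
             observation_model (P1 t) G (gaussian_kernel sigma rho)
               ((b / 2) *: zeta R t)) ->
          (detection_error alpha P0 P1 (observation G n)
             (glrt (cov_matrix (gaussian_kernel sigma rho) n) alpha
                   (thr alpha n delta))
           <= delta%:E)%E].
Proof.
pose A (rho sigma : R) := sigma ^+ 2 * expR (2 * rho ^+ 2)^-1 * rho ^+ 2 / 2.
pose B (alpha : R) := 8 / (1 - 2 * alpha) ^+ 2.
(* With [b^2 (C0 n)^n >= 12^2 L] and a threshold at most [8 L], where [L] is the
   logarithm in the statement, [16] times the threshold is at most [128 L].  The
   bound [A] is what the lower bound on the signal asks of [n], and [B] what the
   comparison of logarithms asks. *)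
exists 12, (fun rho => rho ^+ 2 / (8 * expR 1)),
  (fun rho sigma alpha => (Num.bound (A rho sigma) + Num.bound (B alpha)).+1),
  (fun _ n delta => glrt_threshold n delta); split => //.
- by move=> rho rho0; rewrite divr_gt0 ?exprn_gt0// mulr_gt0 ?expR_gt0.
- by move=> *; exact: glrt_threshold_gt0.
move=> rho sigma alpha delta rho0 sigma0 a01 d01 n n_large b b0 b_large.
move=> d Omega G P0 P1 model0 model1.
have n0 : (0 < n)%N by apply: leq_trans n_large.
have An : A rho sigma <= n%:R.
  have A0 : 0 <= A rho sigma.
    by rewrite divr_ge0// mulr_ge0 ?sqr_ge0// mulr_ge0 ?sqr_ge0 ?expR_ge0.
  apply: (le_trans (ltW (archi_boundP A0))).
  by rewrite ler_nat (leq_trans _ n_large)// ltnW// ltnS leq_addr.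
have Bn : B alpha <= n%:R.
  have B0 : 0 <= B alpha by rewrite divr_ge0// sqr_ge0.
  apply: (le_trans (ltW (archi_boundP B0))).
  by rewrite ler_nat (leq_trans _ n_large)// ltnW// ltnS leq_addl.
have /andP[a0 a1] := a01; have /andP[d0 d1] := d01.
have tl := glrt_threshold_tail n d01.
have N1 : 1 <= n.+1%:R :> R by rewrite ler1n.
have N0 : 0 < n.+1%:R :> R by [].
set thr := glrt_threshold n delta.
have thr0 : 0 < thr by exact: glrt_threshold_gt0.
have thr_le := glrt_threshold_le_ln a01 d01 Bn.
have strong t : t \in change_points n alpha ->
    16 * thr <= b ^+ 2 * signal sigma rho t.
  move=> /(change_points_range a0) tn.
  have q_lb := signal_strength_lb sigma0 rho0 tn An.
  set q := signal _ _ _; rewrite -/q in q_lb.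
  set c := rho ^+ 2 / (8 * expR 1) * n%:R in q_lb b_large.
  have c0 : 0 < c by rewrite mulr_gt0 ?ltr0n// divr_gt0 ?exprn_gt0// mulr_gt0 ?expR_gt0.
  have eE : expR (- (n%:R * ln c)) = (c ^+ n)^-1.
    by rewrite expRN expRM_natl lnK.
  have cn0 : 0 < c ^+ n by rewrite exprn_gt0.
  rewrite {}eE in b_large; set L := ln _ in b_large thr_le.
  have L0 : 0 <= L by move: thr0 thr_le; rewrite -/thr; lra.
  have bL : 144 * L <= b ^+ 2 * c ^+ n.
    have := b_large; rewrite -(@ler_pXn2r _ 2)// ?nnegrE// ?mulr_ge0 ?sqrtr_ge0//.
    rewrite real_normK ?num_real// exprMn sqr_sqrtr; last first.
      by rewrite mulr_ge0// invr_ge0 ltW.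
    rewrite -(ler_pM2r cn0); congr (_ <= _).
    by move: (c ^+ n) cn0 => k k0; field; rewrite gt_eqF.
  apply: (@le_trans _ _ (b ^+ 2 * c ^+ n)); last first.
    by rewrite ler_wpM2l ?sqr_ge0.
  by move: thr_le; rewrite -/thr; lra.
rewrite /detection_error.
apply: (@le_trans _ _ ((delta / 4)%:E + (delta / 4)%:E)%E); last first.
  by rewrite -EFinD lee_fin; lra.
apply: leeD.
  apply: le_trans (glrt_false_alarm alpha sigma0 rho0 thr0 n0 model0) _.
  by rewrite lee_fin tl mulrC divfK// gt_eqF.
apply: bigmax_le => [|t tc]; first by rewrite lee_fin divr_ge0// ltW.
apply: le_trans (glrt_miss sigma0 rho0 thr0 n0 tc (model1 t tc) (strong t tc)) _.
by rewrite lee_fin tl ler_pdivrMr// ler_peMr// divr_ge0// ltW.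
Qed.
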